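(* Let $G$ be a group, let $\mathcal A=\prod_{\lambda\in\Lambda}\mathcal A_\lambda$ be a product of commutative indecomposable unital rings, let $\alpha$ be a unital partial action of $G$ on $\mathcal A$, let $n>0$ and let $w_1,w_2\in Z^n(G,\mathcal A)$. Suppose that $(\beta,\mathcal B)$ is an enveloping action of $(\alpha,\mathcal A)$ and that $u_i\in Z^n(G,\mathcal U(\mathcal M(\mathcal B)))$ is a globalization of $w_i$, $i=1,2$. If $w_1$ is cohomologous to $w_2$, then $u_1$ is cohomologous to $u_2$. In particular, any two globalizations of the same partial $n$-cocycle are cohomologous.
   Context: Rings are associative, not necessarily unital; $\mathcal U(\cdot)$ denotes the group of invertible elements. A unital ring is indecomposable if it is nonzero and its only central idempotents are $0$ and $1$; the product may be infinite. A partial action $\alpha$ of a group $G$ (identity $1$) on a ring $\mathcal A$ is a collection of two-sided ideals $\mathcal D_g\subseteq\mathcal A$ and ring isomorphisms $\alpha_g:\mathcal D_{g^{-1}}\to\mathcal D_g$ ($g\in G$) such that (i) $\mathcal D_1=\mathcal A$, $\alpha_1=\mathrm{id}$; (ii) $\alpha_g(\mathcal D_{g^{-1}}\cap\mathcal D_h)=\mathcal D_g\cap\mathcal D_{gh}$; (iii) $\alpha_g(\alpha_h(a))=\alpha_{gh}(a)$ for $a\in\mathcal D_{h^{-1}}\cap\mathcal D_{h^{-1}g^{-1}}$. It is unital if every $\mathcal D_g=1_g\mathcal A$ for an idempotent $1_g$ central in $\mathcal A$ (so $\mathcal A$ has identity $1_{\mathcal A}=1_1$). Partial cohomology ($\mathcal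 A$ commutative, $\alpha$ unital). For $n\ge1$ put $1_{(x_1,\dots,x_n)}=1_{x_1}1_{x_1x_2}\cdots1_{x_1\cdots x_n}$ and $\mathcal D_{(x_1,\dots,x_n)}=1_{(x_1,\dots,x_n)}\mathcal A$. $C^n(G,\mathcal A)$ is the abelian group (pointwise multiplication) of functions $f:G^n\to\mathcal A$ with $f(x_1,\dots,x_n)$ invertible in the ideal $\mathcal D_{(x_1,\dots,x_n)}$ (whose identity is $1_{(x_1,\dots,x_n)}$); inverses are taken in these ideals. $C^0(G,\mathcal A)=\mathcal U(\mathcal A)$. For $n\ge 1$, $(\delta^nf)(x_1,\dots,x_{n+1})=\alpha_{x_1}(1_{x_1^{-1}}f(x_2,\dots,x_{n+1}))\prod_{i=1}^nf(x_1,\dots,x_ix_{i+1},\dots,x_{n+1})^{(-1)^i}\cdot f(x_1,\dots,x_n)^{(-1)^{n+1}}$, and $(\delta^0a)(x)=\alpha_x(1_{x^{-1}}a)a^{-1}$. $Z^n(G,\mathcal A)=\ker\delta^n$, $B^n(G,\mathcal A)=\operatorname{im}\delta^{n-1}$ ($n\ge1$); two partial $n$-cocycles are cohomologous if they have the same class in $H^n(G,\mathcal A)=Z^n(G,\mathcal A)/B^n(G,\mathcal A)$. Globalization. An enveloping action of $\alpha$ is a (global) action $\beta$ of $G$ by automorphisms on a ring $\mathcal B$ together with an injective ring homomorphism $\varphi:\mathcal A\to\mathcal B$ such that $\varphi(\mathcal A)$ is a two-sided ideal of $\mathcal B$, $\varphi(\mathcal D_g)=\varphi(\mathcal A)\cap\beta_g(\varphi(\mathcal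 A))$, $\varphi(\alpha_g(a))=\beta_g(\varphi(a))$ for $a\in\mathcal D_{g^{-1}}$, and $\mathcal B=\sum_{g\in G}\beta_g(\varphi(\mathcal A))$. It is known that it exists for unital $\alpha$ on a unital ring and is unique up to isomorphism. The multiplier ring $\mathcal M(\mathcal B)$ is the ring of pairs $u=(R,L)$ of a left $\mathcal B$-module endomorphism $R$ (written on the right) and a right $\mathcal B$-module endomorphism $L$ of $\mathcal B$ with $(aR)b=a(Lb)$ for all $a,b\in\mathcal B$; one writes $au=aR$, $ua=La$. For commutative $\mathcal A$, both $\mathcal B$ and $\mathcal M(\mathcal B)$ are commutative. $G$ acts on $\mathcal M(\mathcal B)$ by $\beta^*_g(u)=\beta_gu\beta_g^{-1}=(\beta_g^{-1}R\beta_g,\beta_gL\beta_g^{-1})$, and $\mathcal U(\mathcal M(\mathcal B))$ is a $G$-module via $\beta^*$. A globalization of $w\in Z^n(G,\mathcal A)$ is a classical $n$-cocycle $u\in Z^n(G,\mathcal U(\mathcal M(\mathcal B)))$ with $\varphi(w(x_1,\dots,x_n))=\varphi(1_{(x_1,\dots,x_n)})u(x_1,\dots,x_n)$ for all $x_1,\dots,x_n\in G$. Cohomologous globalizations means cohomologous as classical cocycles of $G$ with values in the $G$-module $\mathcal U(\mathcal M(\mathcal B))$. *)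

(* Defs.v *)
From HB Require Import structures.
From mathcomp Require Import all_boot all_algebra.
From mathcomp Require Import boolp classical_sets functions.

Set Implicit Arguments.
Unset Strict Implicit.
Unset Printing Implicit Defensive.

Import GRing.Theory.

Local Open Scope classical_set_scope.
Local Open Scope ring_scope.

(* Associative, not necessarily unital rings. *)
HB.mixin Record Zmodule_isRng B of GRing.Zmodule B := {
  rngmul : B -> B -> B;
  rngmulA : associative rngmul;
  rngmulDl : left_distributive rngmul +%R;
  rngmulDr : right_distributive rngmul +%R
}.

#[short(type="rngType")]
HB.structure Definition Rng := { B of Zmodule_isRng B & GRing.Zmodule B }.

Notation "a ** b" := (rngmul a b) (at level 40, left associativity) : ring_scope.

(* The multiplication is a parameter, so that the same predicate serves unital
   rings ( *%R ) and rings without unit (rngmul). *)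
Definition ideal (V : zmodType) (mul : V -> V -> V) (I : set V) : Prop :=
  [/\ I 0, (forall a b, I a -> I b -> I (a - b)) &
      (forall a b, I a -> I (mul a b) /\ I (mul b a))].

Definition principal (R : pzRingType) (e : R) : set R :=
  [set e * a | a in setT].

Definition indecomposable (R : pzRingType) : Prop :=
  (1 : R) <> 0 /\
  (forall e : R, e * e = e -> (forall a, e * a = a * e) -> e = 0 \/ e = 1).

(* The ring of all families (a_l)_l, with componentwise operations; it is the
   zero ring when L is empty. *)
Section ProductRing.
Variables (L : Type) (A : L -> comPzRingType).

Definition product_ring : Type := forall l, A l.

HB.instance Definition _ := gen_eqMixin product_ring.
HB.instance Definition _ := gen_choiceMixin product_ring.

Implicit Types a b c : product_ring.

Definition prodr_zero : product_ring := fun=> 0.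
Definition prodr_one : product_ring := fun=> 1.
Definition prodr_opp a : product_ring := fun l => - a l.
Definition prodr_add a b : product_ring := fun l => a l + b l.
Definition prodr_mul a b : product_ring := fun l => a l * b l.

Fact prodr_addA : associative prodr_add.
Proof. by move=> a b c; apply: functional_extensionality_dep => l; exact: addrA. Qed.
Fact prodr_addC : commutative prodr_add.
Proof. by move=> a b; apply: functional_extensionality_dep => l; exact: addrC. Qed.
Fact prodr_add0 : left_id prodr_zero prodr_add.
Proof. by move=> a; apply: functional_extensionality_dep => l; exact: add0r. Qed.
Fact prodr_addN : left_inverse prodr_zero prodr_opp prodr_add.
Proof. by move=> a; apply: functional_extensionality_dep => l; exact: addNr. Qed.

HB.instance Definition _ :=
  GRing.isZmodule.Build product_ring prodr_addA prodr_addC prodr_add0 prodr_addN.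

Fact prodr_mulA : associative prodr_mul.
Proof. by move=> a b c; apply: functional_extensionality_dep => l; exact: mulrA. Qed.
Fact prodr_mul1 : left_id prodr_one prodr_mul.
Proof. by move=> a; apply: functional_extensionality_dep => l; exact: mul1r. Qed.
Fact prodr_mulr1 : right_id prodr_one prodr_mul.
Proof. by move=> a; apply: functional_extensionality_dep => l; exact: mulr1. Qed.
Fact prodr_mulDl : left_distributive prodr_mul +%R.
Proof. by move=> a b c; apply: functional_extensionality_dep => l; exact: mulrDl. Qed.
Fact prodr_mulDr : right_distributive prodr_mul +%R.
Proof. by move=> a b c; apply: functional_extensionality_dep => l; exact: mulrDr. Qed.

HB.instance Definition _ :=
  GRing.Zmodule_isPzRing.Build product_ring prodr_mulA prodr_mul1 prodr_mulr1 prodr_mulDl prodr_mulDr.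

Fact prodr_mulC : @commutative product_ring product_ring *%R.
Proof. by move=> a b; apply: functional_extensionality_dep => l; exact: mulrC. Qed.

HB.instance Definition _ :=
  GRing.PzRing_hasCommutativeMul.Build product_ring prodr_mulC.

End ProductRing.

(* pa_act g is a total function, but only its values on pa_dom g^-1 carry
   meaning; outside of it they are arbitrary and never used. *)
Record partial_action (G : groupType) (A : pzRingType) := PartialAction {
  pa_dom : G -> set A;
  pa_act : G -> A -> A;
  pa_ideal : forall g, ideal *%R (pa_dom g);
  pa_bij : forall g, set_bij (pa_dom g^-1%g) (pa_dom g) (pa_act g);
  pa_actD : forall g a b, pa_dom g^-1%g a -> pa_dom g^-1%g b ->
    pa_act g (a + b) = pa_act g a + pa_act g b;
  pa_actM : forall g a b, pa_dom g^-1%g a -> pa_dom g^-1%g b ->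
    pa_act g (a * b) = pa_act g a * pa_act g b;
  pa_dom1 : pa_dom 1%g = setT;
  pa_act1 : forall a, pa_act 1%g a = a;
  pa_domI : forall g h,
    pa_act g @` (pa_dom g^-1%g `&` pa_dom h) = pa_dom g `&` pa_dom (g * h)%g;
  pa_act_comp : forall g h a,
    pa_dom h^-1%g a -> pa_dom (h^-1 * g^-1)%g a ->
    pa_act g (pa_act h a) = pa_act (g * h)%g a
}.

Record unital_partial_action (G : groupType) (A : pzRingType) :=
  UnitalPartialAction {
  upa_pa :> partial_action G A;
  upa_one : G -> A;
  upa_idem : forall g, upa_one g * upa_one g = upa_one g;
  upa_central : forall g a, upa_one g * a = a * upa_one g;
  upa_domE : forall g, pa_dom upa_pa g = principal (upa_one g)
}.

(* For a central idempotent e, the ideal principal e is a ring with identity e;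
   for e = 1 it is R itself and these are the usual invertibility notions. *)
Section InvertibleInIdeal.
Variable R : pzRingType.
Implicit Types e a b : R.

Definition inverse_in e a b : Prop :=
  [/\ principal e a, principal e b, a * b = e & b * a = e].

Definition invertible_in e a : Prop := exists b, inverse_in e a b.

(* The inverse of a in principal e, and 0 if a is not invertible there. *)
Definition inv_in e a : R := xget 0 [set b | inverse_in e a b].

End InvertibleInIdeal.

(* Elements (x_1, ..., x_n) of G^n are functions on 'I_n; x_(k+1) is x k. *)
Section Tuples.
Variable G : groupType.

Definition tuple_tail n (x : 'I_n.+1 -> G) : 'I_n -> G :=
  fun j => x (lift ord0 j).

Definition tuple_init n (x : 'I_n.+1 -> G) : 'I_n -> G :=
  fun j => x (lift ord_max j).

(* Multiplies the entries at positions i and i+1. *)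
Definition tuple_merge n (i : 'I_n) (x : 'I_n.+1 -> G) : 'I_n -> G :=
  fun j => if (j < i)%N then x (widen_ord (leqnSn n) j)
           else if j == i then (x (widen_ord (leqnSn n) i) * x (lift ord0 i))%g
           else x (lift ord0 j).

Definition partial_prod n (x : 'I_n -> G) (i : 'I_n) : G :=
  (\prod_(j < n | (j <= i)%N) x j)%g.

End Tuples.

(* The multiplicative coboundary formula shared by partial and classical
   cohomology. Here fi is the inverse of the cochain f, and the index i < n
   stands for i+1 in the usual numbering of the factors; this gives
   act x_1 (f ()) * f ()^-1 when n = 0. *)
Definition coboundary_formula (G : groupType) (R : pzRingType)
    (act : G -> R -> R) n (f fi : ('I_n -> G) -> R) (x : 'I_n.+1 -> G) : R :=
  act (x ord0) (f (tuple_tail x))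
  * (\prod_(i < n) (if odd i.+1 then fi else f) (tuple_merge i x))
  * (if odd n.+1 then fi else f) (tuple_init x).

Section PartialCohomology.
Variables (G : groupType) (A : comPzRingType).
Variable alpha : unital_partial_action G A.

(* The idempotent 1_(x_1, ..., x_n); it is 1 for n = 0, so that 0-cochains are
   the invertible elements of A. *)
Definition pone n (x : 'I_n -> G) : A :=
  \prod_(i < n) upa_one alpha (partial_prod x i).

Definition pcochain n (f : ('I_n -> G) -> A) : Prop :=
  forall x, invertible_in (pone x) (f x).

Definition pcoboundary n (f : ('I_n -> G) -> A) : ('I_n.+1 -> G) -> A :=
  coboundary_formula (fun g a => pa_act alpha g (upa_one alpha g^-1%g * a))
    f (fun x => inv_in (pone x) (f x)).

Definition pcocycle n (f : ('I_n -> G) -> A) : Prop :=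
  pcochain f /\ forall x, pcoboundary f x = pone x.

Definition pcohomologous n (f f' : ('I_n.+1 -> G) -> A) : Prop :=
  exists2 v : ('I_n -> G) -> A,
    pcochain v & forall x, f x = f' x * pcoboundary v x.

End PartialCohomology.

(* Classical cohomology of G with values in the unit group of a ring M on which
   G acts by gamma. The ring M(B) below is commutative in the case of interest,
   but as this is a theorem, the factors are given a fixed order here. *)
Section ClassicalCohomology.
Variables (G : groupType) (M : pzRingType) (gamma : G -> M -> M).

Definition cochain n (f : ('I_n -> G) -> M) : Prop :=
  forall x, invertible_in 1 (f x).

Definition coboundary n (f : ('I_n -> G) -> M) : ('I_n.+1 -> G) -> M :=
  coboundary_formula gamma f (fun x => inv_in 1 (f x)).

Definition cocycle n (f : ('I_n -> G) -> M) : Prop :=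
  cochain f /\ forall x, coboundary f x = 1.

Definition cohomologous n (f f' : ('I_n.+1 -> G) -> M) : Prop :=
  exists2 v : ('I_n -> G) -> M,
    cochain v & forall x, f x = f' x * coboundary v x.

End ClassicalCohomology.

(* The automorphism inverse to ga_act g is ga_act g^-1. *)
Record global_action (G : groupType) (B : rngType) := GlobalAction {
  ga_act :> G -> B -> B;
  ga_actD : forall g a b, ga_act g (a + b) = ga_act g a + ga_act g b;
  ga_actM : forall g a b, ga_act g (a ** b) = ga_act g a ** ga_act g b;
  ga_act1 : forall a, ga_act 1%g a = a;
  ga_act_comp : forall g h a, ga_act (g * h)%g a = ga_act g (ga_act h a)
}.

Record enveloping (G : groupType) (A : pzRingType) (alpha : partial_action G A)
    (B : rngType) (beta : global_action G B) (phi : A -> B) : Prop :=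
  Enveloping {
  env_D : forall a b, phi (a + b) = phi a + phi b;
  env_M : forall a b, phi (a * b) = phi a ** phi b;
  env_inj : injective phi;
  env_ideal : ideal (@rngmul B) (range phi);
  env_dom : forall g,
    phi @` pa_dom alpha g = range phi `&` (beta g @` range phi);
  env_act : forall g a, pa_dom alpha g^-1%g a ->
    phi (pa_act alpha g a) = beta g (phi a);
  env_sum : forall b, exists s : seq (G * A),
    b = \sum_(p <- s) beta p.1 (phi p.2)
}.

Section Multipliers.
Variable B : rngType.

Definition multiplier_axiom (r l : B -> B) : Prop :=
  [/\ (forall a b, r (a + b) = r a + r b) /\ (forall a b, r (a ** b) = a ** r b),
      (forall a b, l (a + b) = l a + l b) /\ (forall a b, l (a ** b) = l a ** b) &
      forall a b, r a ** b = a ** l b].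

(* A multiplier u = (R, L): rmult u a is a R = a u, and lmult u a is L a = u a. *)
Record multiplier := Multiplier {
  rmult : B -> B;
  lmult : B -> B;
  multiplierP : multiplier_axiom rmult lmult
}.

HB.instance Definition _ := gen_eqMixin multiplier.
HB.instance Definition _ := gen_choiceMixin multiplier.

Lemma multiplier_eq (u v : multiplier) :
  rmult u =1 rmult v -> lmult u =1 lmult v -> u = v.
Proof.
case: u v => [r l p] [r' l' p'] /= /funext rr' /funext ll'.
by subst r' l'; congr Multiplier.
Qed.

Lemma rngmul0l (b : B) : 0 ** b = 0.
Proof. by apply: (addrI (0 ** b)); rewrite -rngmulDl !addr0. Qed.

Lemma rngmul0r (b : B) : b ** 0 = 0.
Proof. by apply: (addrI (b ** 0)); rewrite -rngmulDr !addr0. Qed.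

Lemma rngmulNl (a b : B) : (- a) ** b = - (a ** b).
Proof. by apply: (addrI (a ** b)); rewrite -rngmulDl !subrr rngmul0l. Qed.

Lemma rngmulNr (a b : B) : a ** (- b) = - (a ** b).
Proof. by apply: (addrI (a ** b)); rewrite -rngmulDr !subrr rngmul0r. Qed.

Fact zero_multiplierP : multiplier_axiom (fun=> 0) (fun=> 0).
Proof. by split; [split|split|] => *; rewrite ?addr0 ?rngmul0l ?rngmul0r. Qed.

Fact one_multiplierP : multiplier_axiom id id.
Proof. by []. Qed.

Fact opp_multiplierP u :
  multiplier_axiom (fun a => - rmult u a) (fun a => - lmult u a).
Proof.
case: u => r l [[rD rM] [lD lM] rl] /=.
by split; [split|split|] => a b;
  rewrite ?rD ?lD ?rM ?lM ?opprD ?rngmulNl ?rngmulNr ?rl.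
Qed.

Fact add_multiplierP u v :
  multiplier_axiom (fun a => rmult u a + rmult v a)
                   (fun a => lmult u a + lmult v a).
Proof.
case: u v => r l [[rD rM] [lD lM] rl] [r' l' [[rD' rM'] [lD' lM'] rl']] /=.
by split; [split|split|] => a b;
  rewrite ?rD ?lD ?rD' ?lD' ?rM ?lM ?rM' ?lM' ?rngmulDl ?rngmulDr ?rl ?rl' //
          addrACA.
Qed.

Fact mul_multiplierP u v :
  multiplier_axiom (fun a => rmult v (rmult u a)) (fun a => lmult u (lmult v a)).
Proof.
case: u v => r l [[rD rM] [lD lM] rl] [r' l' [[rD' rM'] [lD' lM'] rl']] /=.
by split; [split|split|] => a b;
  rewrite ?rD ?lD' ?rD' ?lD ?rM ?lM' ?rM' ?lM ?rl' ?rl.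
Qed.

Definition mult_zero := Multiplier zero_multiplierP.
Definition mult_one := Multiplier one_multiplierP.
Definition mult_opp u := Multiplier (opp_multiplierP u).
Definition mult_add u v := Multiplier (add_multiplierP u v).
(* The component R acts on the right: a (u v) = (a u) v. *)
Definition mult_mul u v := Multiplier (mul_multiplierP u v).

Fact mult_addA : associative mult_add.
Proof. by move=> u v w; apply: multiplier_eq => a; exact: addrA. Qed.
Fact mult_addC : commutative mult_add.
Proof. by move=> u v; apply: multiplier_eq => a; exact: addrC. Qed.
Fact mult_add0 : left_id mult_zero mult_add.
Proof. by move=> u; apply: multiplier_eq => a; exact: add0r. Qed.
Fact mult_addN : left_inverse mult_zero mult_opp mult_add.
Proof. by move=> u; apply: multiplier_eq => a; exact: addNr. Qed.

HB.instance Definition _ :=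
  GRing.isZmodule.Build multiplier mult_addA mult_addC mult_add0 mult_addN.

Fact mult_mulA : associative mult_mul.
Proof. by move=> u v w; exact: multiplier_eq. Qed.
Fact mult_mul1 : left_id mult_one mult_mul.
Proof. by move=> u; exact: multiplier_eq. Qed.
Fact mult_mulr1 : right_id mult_one mult_mul.
Proof. by move=> u; exact: multiplier_eq. Qed.
Fact mult_mulDl : left_distributive mult_mul +%R.
Proof.
move=> u v w; apply: multiplier_eq => a //=.
by have [[-> _] _ _] := multiplierP w.
Qed.
Fact mult_mulDr : right_distributive mult_mul +%R.
Proof.
move=> u v w; apply: multiplier_eq => a //=.
by have [_ [-> _] _] := multiplierP u.
Qed.

HB.instance Definition _ :=
  GRing.Zmodule_isPzRing.Build multiplier mult_mulA mult_mul1 mult_mulr1 mult_mulDl mult_mulDr.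

End Multipliers.

Section MultiplierAction.
Variables (G : groupType) (B : rngType) (beta : global_action G B).

Fact beta_star_axiom g (u : multiplier B) :
  multiplier_axiom (fun a => beta g (rmult u (beta g^-1%g a)))
                   (fun a => beta g (lmult u (beta g^-1%g a))).
Proof.
have bK b : beta g (beta g^-1%g b) = b by rewrite -ga_act_comp mulgV ga_act1.
case: u => r l [[rD rM] [lD lM] rl] /=; split; [split|split|] => a b.
- by rewrite !ga_actD rD ga_actD.
- by rewrite !ga_actM rM ga_actM bK.
- by rewrite !ga_actD lD ga_actD.
- by rewrite !ga_actM lM ga_actM bK.
- by rewrite -{1}[b]bK -ga_actM rl ga_actM bK.
Qed.

(* beta_g^-1 R beta_g is composed from left to right, as R acts on the right,
   so both components have the same shape as functions. *)
Definition beta_star (g : G) (u : multiplier B) : multiplier B :=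
  Multiplier (beta_star_axiom g u).

End MultiplierAction.

Definition globalization (G : groupType) (A : comPzRingType)
    (alpha : unital_partial_action G A) (B : rngType)
    (beta : global_action G B) (phi : A -> B) n
    (w : ('I_n -> G) -> A) (u : ('I_n -> G) -> multiplier B) : Prop :=
  cocycle (beta_star beta) u /\
  forall x, phi (w x) = rmult (u x) (phi (pone alpha x)).

(* Main.v *)
(* Write 1_g for the identity of D_g and U(.) for unit groups.  The multiplier ring
   of B is the ring of functions p : G -> A with
   alpha_y(1_(y^-1) p(g)) = 1_y p(g y^-1), on which G acts by translation of the
   argument.  Hence, for every block A_l of A, a cocycle u with values in
   U(M(B)) gives a homogeneous cocycle F_l on G with trivial action and values
   in U(A_l), namely
     F_l(h_0, ..., h_n) = u(h_0 h_1^-1, ..., h_(n-1) h_n^-1)(h_0)_l,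
   and these are permuted by the isomorphisms A_l -> A_m induced by the partial
   action: since the blocks are indecomposable, a block is either contained in
   D_(y^-1) and moved by y to another block, or meets it trivially.
   Call h inside l if h moves A_l to a block of A.  On simplices all of whose
   vertices are inside l, F_l is determined by the partial cocycle that u
   globalizes; so the hypothesis says that there F_l := F_l(u_1) / F_l(u_2) is the
   coboundary of some V_l.  The translates of the blocks of A in B form a G-set,
   and choosing for each of them an element of G that brings it back into A
   gives a retraction r_l of G onto the elements inside l, compatibly with the
   moves.  If P is the prism operator, i.e. the homotopy between r_l^* and the
   identity, then W_l := (V_l o r_l) / P F_l is a cochain with coboundary F_l.
   Its compatibility with the moves makes it come from a cochain with values in
   U(M(B)), whose coboundary is u_1 / u_2. *)
From HB Require Import structures.
Require Import Defs.
From mathcomp Require Import all_boot all_algebra.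
From mathcomp Require Import boolp classical_sets.

Set Implicit Arguments.
Unset Strict Implicit.
Unset Printing Implicit Defensive.

Import GRing.Theory.

Local Open Scope classical_set_scope.
Local Open Scope ring_scope.

(** * Homogeneous cochains *)

Section UnitGroup.
Variable R : comPzRingType.

(* The group of units is written additively, as a zmodType, so that alternating
   products of cochains become alternating sums. *)
Record units := Units { uval : R; uinv : R; uvalV : uval * uinv = 1 }.

HB.instance Definition _ := gen_eqMixin units.
HB.instance Definition _ := gen_choiceMixin units.

Lemma uval_inj : injective uval.
Proof.
move=> [a b ab] [a' c ac] /= aa'; subst a'.
have bc : b = c by rewrite -[b]mulr1 -ac mulrA [b * a]mulrC ab mul1r.
by subst c; congr Units; exact: Prop_irrelevance.
Qed.

Definition units_zero := Units (mulr1 (1 : R)).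

Fact units_oppP u : uinv u * uval u = 1.
Proof. by rewrite mulrC uvalV. Qed.

Definition units_opp u := Units (units_oppP u).

Fact units_addP u v : (uval u * uval v) * (uinv u * uinv v) = 1.
Proof. by rewrite mulrACA !uvalV mulr1. Qed.

Definition units_add u v := Units (units_addP u v).

Fact units_addA : associative units_add.
Proof. by move=> u v w; apply: uval_inj; exact: mulrA. Qed.
Fact units_addC : commutative units_add.
Proof. by move=> u v; apply: uval_inj; exact: mulrC. Qed.
Fact units_add0 : left_id units_zero units_add.
Proof. by move=> u; apply: uval_inj; exact: mul1r. Qed.
Fact units_addN : left_inverse units_zero units_opp units_add.
Proof. by move=> u; apply: uval_inj; exact: units_oppP. Qed.

HB.instance Definition _ :=
  GRing.isZmodule.Build units units_addA units_addC units_add0 units_addN.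

Lemma uval0 : uval 0 = 1. Proof. by []. Qed.
Lemma uvalD u v : uval (u + v) = uval u * uval v. Proof. by []. Qed.
Lemma uvalN u : uval (- u) = uinv u. Proof. by []. Qed.

(** The neutral element is the default when [a] is not invertible. *)
Definition to_unit (a : R) : units := xget 0 [set u | uval u = a].

Lemma to_unitK a b : a * b = 1 -> uval (to_unit a) = a.
Proof. by move=> ab; apply: (@xgetPex _ 0 [set u | uval u = a]); exists (Units ab). Qed.

Lemma to_unitN a b : a * b = 1 -> uinv (to_unit a) = b.
Proof.
move=> ab; have E := to_unitK ab.
rewrite -[RHS]mul1r -(uvalV (to_unit a)) E.
by rewrite mulrAC ab mul1r.
Qed.

End UnitGroup.

(* Ordered simplices on T are lists, so that a cochain complex of the simplex on
   T can be handled by structural recursion. *)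
Section SimplexCochains.
Variables (T : Type) (U : zmodType).
Implicit Types (F : seq T -> U) (l s t : seq T).

Fixpoint bd F l : U :=
  if l is h :: s then F s - bd (fun t => F (h :: t)) s else 0.

(** The alternating sum over i of the values of [F] at h_0, ..., h_i, rho h_i, ..., rho h_m. *)
Fixpoint prism (rho : T -> T) F l : U :=
  if l is h :: s then
    F [:: h, rho h & map rho s] - prism rho (fun t => F (h :: t)) s
  else 0.

Lemma eq_bd m F F' l : (forall t, size t = m -> F t = F' t) ->
  size l = m.+1 -> bd F l = bd F' l.
Proof.
elim: l m F F' => //= h s IH m F F' FF' [sm]; rewrite FF' //; congr (_ - _).
case: s IH sm => // h' s IH sm; apply: (IH (size s)) => // t ts.
by apply: FF'; rewrite /= ts -sm.
Qed.

Lemma bdB F F' l : bd (fun t => F t - F' t) l = bd F l - bd F' l.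
Proof.
elim: l F F' => [|h s IH] F F' /=; first by rewrite subr0.
by rewrite IH !opprB -!addrA; congr (_ + _); rewrite [RHS]addrCA [LHS]addrC -addrA.
Qed.

Lemma bd_map (rho : T -> T) F l : bd (fun t => F (map rho t)) l = bd F (map rho l).
Proof. by elim: l F => //= h s IH F; rewrite (IH (fun t => F (rho h :: t))). Qed.

Lemma prismB rho F F' l :
  prism rho (fun t => F t - F' t) l = prism rho F l - prism rho F' l.
Proof.
elim: l F F' => [|h s IH] F F' /=; first by rewrite subr0.
by rewrite IH !opprB -!addrA; congr (_ + _); rewrite [RHS]addrCA [LHS]addrC -addrA.
Qed.

Lemma prism_eq0 rho m F l : (forall t, size t = m.+1 -> F t = 0) ->
  size l = m -> prism rho F l = 0.
Proof.
elim: l m F => //= h s IH m F F0 sm; rewrite F0 /= ?size_map ?sm //.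
by rewrite sub0r (IH (size s)) ?oppr0 // => t ts; apply: F0; rewrite /= ts sm.
Qed.

Lemma prism_homotopy rho F l :
  bd (prism rho F) l + prism rho (bd F) l = F (map rho l) - F l.
Proof.
elim: l F => [|h s IH] F /=; first by rewrite addr0 subrr.
have := IH (fun t => F (h :: t)).
rewrite bdB prismB /=.
rewrite (bd_map rho (fun t => F [:: h, rho h & t])) => {}IH.
(* [X] gathers the faces of the first prism that keep both [h] and [rho h]; it occurs with both
   signs and cancels. *)
set X := bd (fun t => F [:: h, rho h & t]) _; set Y := prism rho F s.
set Z := F (rho h :: _); move: IH; set P := bd _ s; set Q := prism rho _ s.
move=> IH; have -> : F (h :: map rho s) = P + Q + F (h :: s).
  by rewrite IH subrK.
have -> : Y - (X - P) = Y - Q + (P + Q - X).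
  by rewrite opprB addrAC -!addrA; congr (_ + (_ + _)); rewrite addrCA subrr addr0.
move: (Y - Q) (P + Q) => A C.
have -> : Z - (C + F (h :: s) - X) - A = Z - F (h :: s) - (A + (C - X)).
  rewrite -![Z - _ - _]addrA -!opprD; congr (Z - _).
  rewrite [C + _ - X]addrAC [LHS]addrC [LHS]addrA.
  by rewrite [LHS]addrC.
by rewrite addrC subrK.
Qed.

Lemma bd_sum F l :
  bd F l = \sum_(i < size l)
    (if odd i then - F (take i l ++ drop i.+1 l) else F (take i l ++ drop i.+1 l)).
Proof.
elim: l F => [|h s IH] F /=; first by rewrite big_ord0.
rewrite big_ord_recl /= drop0 IH -sumrN; congr (_ + _).
by apply: eq_bigr => i _; rewrite /bump /= add1n /=; case: odd; rewrite ?opprK.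
Qed.

End SimplexCochains.

(** Naturality of the prism operator under a vertex map that intertwines two retractions. The
    coefficients lie in different groups, so they are compared by a relation, later [transfers]. *)
Lemma prism_rel (T : Type) (U U' : zmodType) (C : U -> U' -> Prop) (r rho rho' : T -> T)
    m (F : seq T -> U) (F' : seq T -> U') l :
    C 0 0 -> (forall a a' b b', C a a' -> C b b' -> C (a - b) (a' - b')) ->
    (forall h, rho' (r h) = r (rho h)) ->
    (forall t, size t = m.+1 -> C (F t) (F' (map r t))) -> size l = m ->
  C (prism rho F l) (prism rho' F' (map r l)).
Proof.
move=> C0 CB rE; elim: l m F F' => //= h s IH m F F' CF sm.
apply: CB.
  have -> : [:: r h, rho' (r h) & map rho' (map r s)] =
            map r [:: h, rho h & map rho s].
    by rewrite /= rE -!map_comp; congr [:: _, _ & _]; apply: eq_map => i /=.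
  by apply: CF; rewrite /= size_map sm.
by apply: (IH (size s)) => // t ts; apply: (CF (h :: t)); rewrite /= ts sm.
Qed.

Section Steps.
Variable G : groupType.
Implicit Types (l : seq G) (g h y : G).

(* An inhomogeneous tuple x and a base point g correspond to the homogeneous
   simplex [:: g; x_1^-1 g; (x_1 x_2)^-1 g; ...]. *)
Definition steps n l : 'I_n -> G := fun i => (nth 1 l i * (nth 1 l i.+1)^-1)%g.

Arguments steps : clear implicits.

Fixpoint vertices n : ('I_n -> G) -> G -> seq G :=
  if n is n'.+1 then fun x g => g :: vertices (tuple_tail x) ((x ord0)^-1 * g)%g
  else fun _ g => [:: g].

Lemma size_vertices n (x : 'I_n -> G) g : size (vertices x g) = n.+1.
Proof. by elim: n x g => //= n IH x g; rewrite IH. Qed.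

Lemma head_vertices n (x : 'I_n -> G) g : head 1%g (vertices x g) = g.
Proof. by case: n x. Qed.

Lemma tuple_tail_steps n h l :
  tuple_tail (steps n.+1 (h :: l)) = steps n l.
Proof. by []. Qed.

Lemma steps_vertices n (x : 'I_n -> G) g : steps n (vertices x g) = x.
Proof.
elim: n x g => [|n IH] x g; first by apply: funext => -[].
apply: funext => i; case: (unliftP ord0 i) => [j|] -> /=.
  by rewrite -[LHS]/(steps n (vertices (tuple_tail x) ((x ord0)^-1 * g)%g) j) IH.
by rewrite /steps /= nth0 head_vertices invgM invgK mulVKg.
Qed.

Lemma vertices_steps n l : size l = n.+1 -> vertices (steps n l) (head 1%g l) = l.
Proof.
elim: n l => [|n IH] [|h l] //=; first by case: l.
move=> [sl]; rewrite tuple_tail_steps; congr (_ :: _).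
have -> : ((steps n.+1 (h :: l) ord0)^-1 * h = head 1 l)%g.
  by rewrite /steps /= nth0 invgF mulgVK.
exact: IH.
Qed.

Lemma vertices_mulr n (x : 'I_n -> G) g y :
  vertices x (g * y)%g = map ( *%g^~ y) (vertices x g).
Proof. by elim: n x g => //= n IH x g; rewrite mulgA IH. Qed.

Lemma head_map_mulr l y : (0 < size l)%N ->
  head 1%g (map ( *%g^~ y) l) = (head 1 l * y)%g.
Proof. by case: l. Qed.

Lemma steps_mulr n l y : size l = n.+1 -> steps n (map ( *%g^~ y) l) = steps n l.
Proof.
move=> sl; apply: funext => i; rewrite /steps !(nth_map 1%g) ?sl ?ltnS //; last exact: ltnW.
exact: mulgKA.
Qed.

Lemma partial_prod_steps n l (i : 'I_n) : size l = n.+1 ->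
  partial_prod (steps n l) i = (head 1 l * (nth 1 l i.+1)^-1)%g.
Proof.
move=> sl; rewrite /partial_prod.
elim: n l i sl => [|n IH] [|h l] i //=; first by case: i.
move=> [sl]; rewrite big_mkcond big_ord_recl /= -big_mkcond /=.
case: (unliftP ord0 i) => [j|] -> /=; rewrite /steps /= nth0.
  by rewrite (IH l) // mulgA mulgVK.
by rewrite big_pred0 ?mulg1.
Qed.

Lemma nth_delete l i j : (i < size l)%N ->
  nth 1%g (take i l ++ drop i.+1 l) j = nth 1%g l (if (j < i)%N then j else j.+1).
Proof.
move=> il; rewrite nth_cat size_takel ?(ltnW il) //; case: ltnP => ij.
  by rewrite nth_take.
by rewrite nth_drop addSn subnKC.
Qed.

(** The two quotients that meet at the deleted vertex telescope. *)
Lemma steps_delete n (i : 'I_n) l : size l = n.+2 ->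
  steps n (take i.+1 l ++ drop i.+2 l) = tuple_merge i (steps n.+1 l).
Proof.
move=> sl; have il : (i.+1 < size l)%N by rewrite sl !ltnS ltnW.
apply: funext => j; rewrite /tuple_merge /steps !nth_delete //= /bump /= !add1n.
rewrite !ltnS; case: (ltngtP j i) => [ji|ij|/val_inj ->].
- by [].
- by rewrite -val_eqE /= gtn_eqF.
by rewrite eqxx mulgA mulgVK.
Qed.

Lemma steps_delete_last n l : size l = n.+2 ->
  steps n (take n.+1 l ++ drop n.+2 l) = tuple_init (steps n.+1 l).
Proof.
move=> sl; have il : (n.+1 < size l)%N by rewrite sl.
apply: funext => j; rewrite /tuple_init /steps !nth_delete //= /bump /=.
by rewrite !ltnS ltn_ord ltnW // leqNgt ltn_ord.
Qed.

End Steps.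

Arguments steps {G} n l _.

(** * The coboundary formula as an alternating sum over faces *)

Section CoboundaryOnSimplices.
Variables (G : groupType) (R : pzRingType) (S : comPzRingType).
Variables (act : G -> R -> R) (chi : G -> R -> S) (Q : G -> Prop).
Hypothesis chiM : forall h a b, Q h -> chi h (a * b) = chi h a * chi h b.
Hypothesis chi1 : forall h, Q h -> chi h 1 = 1.
Hypothesis chi_act : forall h x a, Q h -> chi h (act x a) = chi (x^-1 * h)%g a.

Definition simplicial n (f : ('I_n -> G) -> R) (l : seq G) : units S :=
  to_unit (chi (head 1%g l) (f (steps n l))).

(** Dropping the first vertex moves the base point from h to x_1^-1 h, which [chi_act] turns into
    the action of x_1; the other faces give the merged tuples and the initial segment. [Q] allows
    for partial cochains, which are controlled only inside a block. *)
Lemma simplicial_coboundary n (f fi : ('I_n -> G) -> R) l :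
    (forall t, size t = n.+1 -> {in t, forall h, Q h} ->
       chi (head 1%g t) (f (steps n t)) * chi (head 1%g t) (fi (steps n t)) = 1) ->
    size l = n.+2 -> {in l, forall h, Q h} ->
  uval (bd (simplicial f) l) =
    chi (head 1%g l) (coboundary_formula act f fi (steps n.+1 l)).
Proof.
move=> ffi sl Ql.
have Qd i : {in take i l ++ drop i.+1 l, forall h, Q h}.
  by move=> h; rewrite mem_cat => /orP[/mem_take|/mem_drop] /Ql.
have sd i : (i < n.+2)%N -> size (take i l ++ drop i.+1 l) = n.+1.
  by move=> ni; rewrite size_cat size_drop size_takel sl ?subSS ?subnKC // ltnW.
have Q0 : Q (head 1%g l) by apply: Ql; case: (l) sl => // h s _; exact: mem_head.
have hd i : (0 < i)%N -> head 1%g (take i l ++ drop i.+1 l) = head 1%g l.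
  by case: i => // i _; case: (l) sl.
have val_sgn i : (i < n.+2)%N ->
    uval (if odd i then - simplicial f (take i l ++ drop i.+1 l)
          else simplicial f (take i l ++ drop i.+1 l)) =
    chi (head 1%g (take i l ++ drop i.+1 l))
      ((if odd i then fi else f) (steps n (take i l ++ drop i.+1 l))).
  move=> ni; have E := ffi _ (sd i ni) (Qd i); rewrite /simplicial.
  by case: odd; [rewrite uvalN (to_unitN E)|rewrite (to_unitK E)].
rewrite bd_sum sl (big_morph _ (@uvalD S) (@uval0 S)) big_ord_recl big_ord_recr /=.
rewrite /coboundary_formula !chiM // chi_act // mulrA; congr (_ * _ * _).
- rewrite (val_sgn 0%N) // take0 drop1 /=.
  case: (l) sl => // h [|h' s] // _ /=.
  by congr (chi _ _); rewrite /steps /= invgF mulgVK.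
- rewrite (@big_morph _ _ (chi (head 1%g l)) _ _ _ _ (fun a b => chiM a b Q0) (chi1 Q0)).
  apply: eq_bigr => i _; rewrite /bump /= add1n (val_sgn i.+1); last by rewrite !ltnS ltnW.
  by rewrite hd // steps_delete.
- by rewrite /bump /= add1n (val_sgn n.+1) // hd // steps_delete_last.
Qed.

End CoboundaryOnSimplices.

(** * The multiplier ring of an enveloping action *)

Section EnvelopingAction.
Variables (G : groupType) (A : comPzRingType).
Variables (alpha : unital_partial_action G A).
Variables (B : rngType) (beta : global_action G B) (phi : A -> B).
Hypothesis henv : enveloping alpha beta phi.

Let phiM := env_M henv.
Let phi_inj := env_inj henv.

Lemma ga_act0 g : beta g 0 = 0.
Proof. by apply: (addrI (beta g 0)); rewrite -ga_actD !addr0. Qed.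

Lemma ga_actN g b : beta g (- b) = - beta g b.
Proof. by apply: (addrI (beta g b)); rewrite -ga_actD !subrr ga_act0. Qed.

Lemma ga_actK g b : beta g^-1%g (beta g b) = b.
Proof. by rewrite -ga_act_comp mulVg ga_act1. Qed.

Lemma ga_actVK g b : beta g (beta g^-1%g b) = b.
Proof. by rewrite -ga_act_comp mulgV ga_act1. Qed.

Lemma phi0 : phi 0 = 0.
Proof. by apply: (addrI (phi 0)); rewrite -(env_D henv) !addr0. Qed.

Lemma phi_mulr a y : range phi (phi a ** y).
Proof. by have [_ _ /(_ (phi a) y)[]] := env_ideal henv; first by exists a. Qed.

Lemma phi_mull a y : range phi (y ** phi a).
Proof. by have [_ _ /(_ (phi a) y)[]] := env_ideal henv; first by exists a. Qed.

(** As [phi 1] is the identity of the ideal [range phi], [y] can be replaced by an element of this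
    commutative ring. *)
Lemma phiC a y : phi a ** y = y ** phi a.
Proof.
have [b _ bE] := phi_mulr a y; have [c _ cE] := phi_mull 1 y.
have -> : phi a ** y = phi a ** (y ** phi 1).
  by rewrite rngmulA -bE -phiM mulr1.
by rewrite -cE -phiM mulrC phiM cE -rngmulA -phiM mul1r.
Qed.

Lemma phi1_comm y z : phi 1 ** y ** z = y ** (phi 1 ** z).
Proof. by rewrite (phiC 1 y) rngmulA. Qed.

(* The partial action, extended to all of A by first cutting down to the domain;
   it is multiplicative and its composition law holds without side conditions. *)
Definition pshift g a := pa_act alpha g (upa_one alpha g^-1%g * a).

Lemma pdomP g a : pa_dom alpha g a <-> upa_one alpha g * a = a.
Proof.
rewrite upa_domE; split=> [[c _ <-]|<-]; last by exists a.
by rewrite mulrA upa_idem.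
Qed.

Lemma pdom_one g a : pa_dom alpha g (upa_one alpha g * a).
Proof. by rewrite upa_domE; exists a. Qed.

(** The right side lies in [range phi] and in its translate by g, hence in phi(D_g); so it is the
    image under [beta g] of an element of phi(D_(g^-1)), which absorbs the factor 1_(g^-1). *)
Lemma phi_pshift g a : phi (pshift g a) = phi 1 ** beta g (phi a).
Proof.
have gD := pdom_one g^-1%g; rewrite /pshift -[X in phi X]mul1r phiM (env_act henv) //.
have : (range phi `&` (beta g @` range phi)) (phi 1 ** beta g (phi a)).
  split; first exact: phi_mulr.
  have [c _ cE] := phi_mull a (beta g^-1%g (phi 1)).
  by exists (phi c); [exists c|rewrite cE ga_actM ga_actVK].
rewrite -(env_dom henv) => -[d dD dE].
have [_ _ /(_ d dD)[c cD cE]] := pa_bij alpha g.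
have := cD; rewrite pdomP => cE'.
rewrite mulrC phiM ga_actM rngmulA -dE -cE (env_act henv) //.
by rewrite -ga_actM -phiM mulrC cE'.
Qed.

Lemma pshiftM g a b : pshift g (a * b) = pshift g a * pshift g b.
Proof.
rewrite /pshift -pa_actM; try exact: pdom_one.
by rewrite [X in _ = pa_act _ _ X]mulrACA upa_idem.
Qed.

Lemma pshift_dom g a : upa_one alpha g * pshift g a = pshift g a.
Proof.
apply/pdomP; have [+ _ _] := pa_bij alpha g; apply; exact: pdom_one.
Qed.

Lemma pshift_one g : pshift g 1 = upa_one alpha g.
Proof.
have [_ _ /(_ (upa_one alpha g))[|c cD cE]] := pa_bij alpha g.
  by rewrite -[upa_one _ _]mulr1; exact: pdom_one.
rewrite -(pshift_dom g 1) -cE mulrC /pshift -pa_actM //; last exact: pdom_one.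
by rewrite mulr1; move/pdomP: cD => ->.
Qed.

Lemma pshift_comp g h a :
  pshift g (pshift h a) = upa_one alpha g * pshift (g * h)%g a.
Proof.
apply: phi_inj; rewrite phiM -(pshift_one g) !phi_pshift ga_actM -ga_act_comp.
by rewrite -[RHS]phi1_comm !rngmulA -[phi 1 ** phi 1]phiM mul1r.
Qed.

Lemma pshift_id a : pshift 1%g a = a.
Proof. by apply: phi_inj; rewrite phi_pshift ga_act1 -phiM mul1r. Qed.

Lemma pshift0 g : pshift g 0 = 0.
Proof. by apply: phi_inj; rewrite phi_pshift phi0 ga_act0 rngmul0r. Qed.

Lemma pshift_upa_one g h :
  pshift g (upa_one alpha h) = upa_one alpha g * upa_one alpha (g * h)%g.
Proof. by rewrite -pshift_one pshift_comp !pshift_one. Qed.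

(** Only finitely many translates of A are needed to express [b]. Joining their identities by f + e
    - fe gives a local unit for [b], and it kills whatever all the identities [beta g (phi 1)]
    kill. *)
Lemma enveloping_faithful b : (forall g, phi 1 ** beta g b = 0) -> b = 0.
Proof.
move=> b0.
have {}b0 g : beta g (phi 1) ** b = 0.
  by rewrite -[b](ga_actVK g) -ga_actM b0 ga_act0.
suff [e eb ec] : exists2 e, e ** b = b &
    forall c, (forall g, beta g (phi 1) ** c = 0) -> e ** c = 0.
  by rewrite -eb ec.
have [s ->] := env_sum henv b; elim: s => [|[g a] s [e eb ec]].
  by exists 0 => [|c _]; rewrite ?big_nil ?rngmul0r ?rngmul0l.
set f := beta g (phi 1).
have fC y : f ** y = y ** f by rewrite /f -[y](ga_actVK g) -!ga_actM phiC.
exists (f + (e - f ** e)) => [|c c0]; last first.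
  by rewrite !rngmulDl rngmulNl -rngmulA ec // c0 rngmul0r oppr0 !addr0.
rewrite big_cons /=; set y := beta g (phi a); set c := \sum_(p <- s) _.
have fy : f ** y = y by rewrite /y -ga_actM -phiM mul1r.
have fey : f ** (e ** y) = e ** y by rewrite rngmulA (fC e) -rngmulA fy.
rewrite rngmulDr !rngmulDl !rngmulNl -!rngmulA eb fey fy subrr addr0.
by rewrite [f ** c + _]addrCA subrr addr0.
Qed.

(** * Multipliers as functions on the group *)

Definition phi_inv b : A := xget 0 [set a | phi a = b].

Lemma phi_invK b : range phi b -> phi (phi_inv b) = b.
Proof. by case=> a _ ab; apply: (@xgetPex _ 0 [set a | phi a = b]); exists a. Qed.

(* The multiplier ring is identified, through u |-> mval u, with the ring of all
   functions p : G -> A with pshift y (p g) = 1_y p (g y^-1). *)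
Definition mval (u : multiplier B) g : A :=
  phi_inv (rmult (beta_star beta g^-1%g u) (phi 1)).

(** Elements of B become functions on G as well, and multipliers act on them by pointwise
    multiplication. *)
Definition trace b g : A := phi_inv (phi 1 ** beta g^-1%g b).

Lemma rmultM (u : multiplier B) b c : rmult u (b ** c) = b ** rmult u c.
Proof. by have [[_ ->]] := multiplierP u. Qed.

Lemma rlmult (u : multiplier B) b c : rmult u b ** c = b ** lmult u c.
Proof. by have [_ _ ->] := multiplierP u. Qed.

Lemma rmult_phi (u : multiplier B) a : rmult u (phi a) = phi a ** rmult u (phi 1).
Proof. by rewrite -rmultM -phiM mulr1. Qed.

Lemma phi_mval u g : phi (mval u g) = rmult (beta_star beta g^-1%g u) (phi 1).
Proof. by rewrite /mval phi_invK // rmult_phi; exact: phi_mulr. Qed.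

Lemma phi_trace b g : phi (trace b g) = phi 1 ** beta g^-1%g b.
Proof. by rewrite /trace phi_invK //; exact: phi_mulr. Qed.

Lemma mval1 g : mval 1 g = 1.
Proof. by apply: phi_inj; rewrite phi_mval /= ga_actVK. Qed.

Lemma mvalM u v g : mval (u * v) g = mval u g * mval v g.
Proof.
apply: phi_inj; rewrite phiM [X in _ = _ ** X]phi_mval -rmult_phi !phi_mval /=.
by rewrite ga_actK.
Qed.

Lemma mval_act h u g : mval (beta_star beta h u) g = mval u (h^-1 * g)%g.
Proof. by apply: phi_inj; rewrite !phi_mval /= !invgM !invgK !ga_act_comp. Qed.

Lemma mval_compat u y g :
  pshift y (mval u g) = upa_one alpha y * mval u (g * y^-1)%g.
Proof.
apply: phi_inj; rewrite phiM phi_pshift !phi_mval -(pshift_one y) phi_pshift.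
set v := beta_star beta _ u; set v' := beta_star beta _ u.
have -> : beta y (rmult v (phi 1)) = rmult v' (beta y (phi 1)).
  by rewrite /= !invgM !invgK !ga_act_comp ga_actK.
by rewrite -!rmultM -(phiC 1 (phi 1 ** _)) rngmulA -phiM mul1r.
Qed.

Lemma trace_inj b c : trace b =1 trace c -> b = c.
Proof.
move=> bc; apply/eqP; rewrite -subr_eq0; apply/eqP/enveloping_faithful => g.
rewrite ga_actD ga_actN rngmulDr rngmulNr; apply/eqP; rewrite subr_eq0.
by apply/eqP; move/(congr1 phi): (bc g^-1%g); rewrite !phi_trace invgK.
Qed.

Lemma traceD b c g : trace (b + c) g = trace b g + trace c g.
Proof.
by apply: phi_inj; rewrite (env_D henv) !phi_trace ga_actD rngmulDr.
Qed.

Lemma traceM b c g : trace (b ** c) g = trace b g * trace c g.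
Proof.
apply: phi_inj; rewrite phiM !phi_trace ga_actM.
by rewrite -[RHS]phi1_comm !rngmulA -[phi 1 ** phi 1]phiM mul1r.
Qed.

Lemma trace_phi h a g : trace (beta h (phi a)) g = pshift (g^-1 * h)%g a.
Proof. by apply: phi_inj; rewrite phi_trace phi_pshift ga_act_comp. Qed.

Lemma trace_rmult u b g : trace (rmult u b) g = mval u g * trace b g.
Proof.
apply: phi_inj; rewrite mulrC phiM phi_mval -rmult_phi phi_trace.
by rewrite phi_trace rmultM /= invgK ga_actVK.
Qed.

Lemma trace_lmult u b g : trace (lmult u b) g = mval u g * trace b g.
Proof.
apply: phi_inj; rewrite phiM phi_mval !phi_trace rngmulA.
rewrite -(phiC 1) -rmultM -phiM mulr1 rlmult /=.
by rewrite invgK ga_actVK.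
Qed.

Lemma mval_inj u v : mval u =1 mval v -> u = v.
Proof.
by move=> uv; apply: multiplier_eq => b; apply: trace_inj => g;
  rewrite ?trace_rmult ?trace_lmult uv.
Qed.

Lemma mval_surj (p : G -> A) :
    (forall y g, pshift y (p g) = upa_one alpha y * p (g * y^-1)%g) ->
  exists u, mval u =1 p.
Proof.
move=> pE.
have /choice[m mE] b : exists c, forall g, trace c g = p g * trace b g.
  have [s ->] := env_sum henv b; elim: s => [|[h a] s [c cE]].
    by exists 0 => g; rewrite !big_nil; apply: phi_inj;
      rewrite phiM !phi_trace ga_act0 rngmul0r rngmul0r.
  (* On a generator, compatibility of [p] lets the value [p h] stand in for [p g]. *)
  exists (beta h (phi (a * p h)) + c) => g.
  rewrite big_cons /= !traceD cE mulrDr; congr (_ + _).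
  rewrite !trace_phi pshiftM pE mulrA [_ * upa_one _ _]mulrC.
  by rewrite pshift_dom invgM invgK mulVKg mulrC.
have mP : multiplier_axiom m m.
  split; [split|split|] => a b; apply: trace_inj => g.
  - by rewrite traceD !mE traceD mulrDr.
  - by rewrite traceM !mE traceM mulrCA.
  - by rewrite traceD !mE traceD mulrDr.
  - by rewrite traceM !mE traceM mulrA.
  - by rewrite !traceM !mE [RHS]mulrCA mulrA.
exists (Multiplier mP) => g.
have t1 : trace (beta g (phi 1)) g = 1 by rewrite trace_phi mulVg pshift_id.
by rewrite -[LHS]mulr1 -[RHS]mulr1 -t1 -trace_rmult /= mE.
Qed.

End EnvelopingAction.

Lemma inv_inP (R : pzRingType) (e a : R) :
  invertible_in e a -> inverse_in e a (inv_in e a).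
Proof. by move=> ea; apply: (@xgetPex _ 0 [set b | inverse_in e a b]). Qed.

Lemma cochainV (G : groupType) (M : pzRingType) n (f : ('I_n -> G) -> M) x :
  cochain f -> f x * inv_in 1 (f x) = 1.
Proof. by move=> /(_ x)/inv_inP[]. Qed.

(** * Gluing over the blocks of the product *)

Section Product.
Variables (G : groupType) (L : Type) (A : L -> comPzRingType).
Hypothesis hA : forall l, indecomposable (A l).
Variable alpha : unital_partial_action G (product_ring A).
Variables (B : rngType) (beta : global_action G B) (phi : product_ring A -> B).
Hypothesis henv : enveloping alpha beta phi.
Implicit Types (a b : product_ring A) (l m : L) (g h y : G) (t : seq G).

Local Notation one := (upa_one alpha).
Local Notation pshift := (pshift alpha).
Local Notation mval := (mval beta phi).

(** * The blocks and their moves *)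

Lemma prodM a b l : (a * b) l = a l * b l. Proof. by []. Qed.

Lemma idempotent_coord a l : a * a = a -> a l = 0 \/ a l = 1.
Proof.
move=> aa; have [_ h01] := hA l; apply: h01 => [|b]; last exact: mulrC.
by rewrite -prodM aa.
Qed.

Definition coord l : product_ring A :=
  fun m => if pselect (l = m) is left _ then 1 else 0.

Lemma coordl l : coord l l = 1.
Proof. by rewrite /coord; case: pselect. Qed.

Lemma coord_mul l a b : a l = b l -> coord l * a = coord l * b.
Proof.
move=> ab; apply: functional_extensionality_dep => m; rewrite !prodM /coord.
by case: pselect => [lm|]; [subst m; rewrite ab|rewrite !mul0r].
Qed.

Lemma coordMl l a : (coord l * a) l = a l.
Proof. by rewrite prodM coordl mul1r. Qed.

(* y maps the block A_l, contained in D_{y^-1}, onto the block A_m. *)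
Definition moves y l m := one y^-1%g l = 1 /\ pshift y (coord l) = coord m.

Lemma moves_one y l m : moves y l m -> one y m = 1.
Proof.
case=> _ yl; rewrite -[LHS]mulr1 -(coordl m) -prodM -yl.
by rewrite (pshift_dom alpha) yl coordl.
Qed.

(** Multiplying by [coord m], the image of [coord l], leaves the coordinate at m unchanged and
    discards all of [a] but [a l]. *)
Lemma moves_local y l m a b : moves y l m -> a l = b l -> pshift y a m = pshift y b m.
Proof.
case=> _ yl ab; rewrite -[LHS]coordMl -[RHS]coordMl -yl.
by rewrite -!(pshiftM alpha) (coord_mul ab).
Qed.

(** Pulling [coord m] back by y gives a nonzero idempotent, so some coordinate l of it is 1. Then y
    sends [coord l] to a nonzero idempotent below [coord m], which is [coord m] by
    indecomposability. *)
Lemma moves_exists y m : one y m = 1 -> exists l, moves y l m.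
Proof.
move=> ym; pose f := pshift y^-1%g (coord m).
have coord_idem l : coord l * coord l = coord l.
  by rewrite -[RHS]mulr1; apply: coord_mul; rewrite coordl.
have sK g a : pshift g (pshift g^-1%g a) = one g * a.
  by rewrite (pshift_comp henv) mulgV (pshift_id henv).
have ff : f * f = f by rewrite -(pshiftM alpha) coord_idem.
have [l fl] : exists l, f l = 1.
  apply: contrapT => nf.
  have f0 : f = 0.
    apply: functional_extensionality_dep => l.
    by case: (idempotent_coord l ff) => // fl; case: nf; exists l.
  have /(congr1 (fun a => a m)) := sK y (coord m).
  rewrite -/f f0 (pshift0 henv) prodM ym coordl mulr1.
  by move=> e; have [[]] := hA m.
have l1 : one y^-1%g l = 1.
  by rewrite -[LHS]mulr1 -fl -prodM (pshift_dom alpha).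
exists l; split=> //.
set e := pshift y (coord l).
have eE : e = coord m * e.
  rewrite /e -[coord l]mulr1 -(coord_mul (b := 1) fl) (pshiftM alpha) sK.
  have -> : one y * coord m = coord m.
    by rewrite mulrC -[RHS]mulr1; apply: coord_mul.
  by rewrite [RHS]mulrCA coord_idem.
have ee : e * e = e by rewrite -(pshiftM alpha) coord_idem.
case: (idempotent_coord m ee) => em.
  have e0 : e = 0 by rewrite eE -[RHS](mulr0 (coord m)); apply: coord_mul.
  have := sK y^-1%g (coord l).
  rewrite invgK -/e e0 (pshift0 henv) => /(congr1 (fun a => a l)).
  by rewrite prodM l1 coordl mulr1 => e1; have [[]] := hA l.
by rewrite eE -[RHS]mulr1; apply: coord_mul.
Qed.

Lemma moves_beta y l m : moves y l m -> beta y (phi (coord l)) = phi (coord m).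
Proof.
case=> yl ylm.
have E : one y^-1%g * coord l = coord l.
  by rewrite mulrC -[RHS]mulr1; apply: coord_mul.
rewrite -ylm /pshift E (env_act henv) //.
by rewrite -E; exact: pdom_one.
Qed.

(* t is the image of s under the isomorphism A_l -> A_m induced by y. *)
Definition transfers y l m (s : units (A l)) (t : units (A m)) :=
  exists a b, [/\ a l = uval s, b l = uinv s,
    pshift y a m = uval t & pshift y b m = uinv t].

Lemma transfers0 y l m : moves y l m -> transfers y (0 : units (A l)) (0 : units (A m)).
Proof.
move=> /moves_one yE; exists 1, 1; split=> //;
  by rewrite (pshift_one alpha) yE.
Qed.

Lemma transfersB y l m (s s' : units (A l)) (t t' : units (A m)) :
  transfers y s t -> transfers y s' t' -> transfers y (s - s') (t - t').
Proof.
move=> [a [b [al bl am bm]]] [a' [b' [al' bl' am' bm']]].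
exists (a * b'), (b * a').
by split; rewrite ?(pshiftM alpha) !prodM ?al ?bl ?al' ?bl' ?am ?bm ?am' ?bm'.
Qed.

Lemma transfers_to_unit y l m a b : moves y l m -> a l * b l = 1 ->
  transfers y (to_unit (a l)) (to_unit (pshift y a m)).
Proof.
move=> yE ab.
have ab' : pshift y a m * pshift y b m = 1.
  rewrite -prodM -(pshiftM alpha) (@moves_local _ l _ _ 1) //.
  by rewrite (pshift_one alpha) (moves_one yE).
by exists a, b; rewrite (to_unitK ab) (to_unitN ab) (to_unitK ab') (to_unitN ab').
Qed.

(* The block A_l is contained in D_(h^-1), so that h moves it to a block of A. *)
Definition inside l h := one h^-1%g l = 1.

(** The choice depends only on the translated block in B, not on how it is written as a translate;
    this makes the retractions compatible with moves. *)
Definition anchor (b : B) : G := xget 1%g [set g | exists a, b = beta g (phi a)].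

Definition retract l h : G := ((anchor (beta h (phi (coord l))))^-1 * h)%g.

Lemma inside_retract l h : inside l (retract l h).
Proof.
rewrite /inside /retract invgM invgK; set r := anchor _.
have [a aE] : exists a, beta h (phi (coord l)) = beta r (phi a).
  apply: (@xgetPex _ 1%g [set g | exists a, _ = beta g (phi a)]).
  by exists h, (coord l).
(* So [coord l] lies in the domain at h^-1 r, whose idempotent is therefore 1 at l. *)
have : (range phi `&` (beta (h^-1 * r)%g @` range phi)) (phi (coord l)).
  split; first by exists (coord l).
  by exists (phi a); [exists a|rewrite ga_act_comp -aE ga_actK].
rewrite -(env_dom henv) => -[d /pdomP dD /(env_inj henv) dl].
by rewrite -[LHS]mulr1 -(coordl l) -dl -prodM dD.
Qed.

Lemma retract_moves y l m h : moves y l m ->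
  retract m (h * y^-1)%g = (retract l h * y^-1)%g.
Proof.
by move=> /moves_beta yE; rewrite /retract ga_act_comp -yE ga_actK mulgA.
Qed.

(** * Gluing cochains given block by block *)

Definition msimplicial n (u : ('I_n -> G) -> multiplier B) l : seq G -> units (A l) :=
  simplicial (fun h v => mval v h l) u.

Lemma msimplicial_coboundary n (u : ('I_n -> G) -> multiplier B) l t :
    cochain u -> size t = n.+2 ->
  uval (bd (msimplicial u l) t) =
    mval (coboundary (beta_star beta) u (steps n.+1 t)) (head 1%g t) l.
Proof.
move=> uU st.
apply: (@simplicial_coboundary _ _ _ _ _ (fun=> True)) => //.
- by move=> h a b _; rewrite (mvalM henv).
- by move=> h _; rewrite (mval1 henv).
- by move=> h x a _; rewrite (mval_act henv).
- by move=> s _ _; rewrite -prodM -(mvalM henv) (cochainV _ uU) (mval1 henv).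
Qed.

Lemma uval_msimplicial n (u : ('I_n -> G) -> multiplier B) l t :
  cochain u -> uval (msimplicial u l t) = mval (u (steps n t)) (head 1%g t) l.
Proof.
move=> uU; rewrite (to_unitK (b := mval (inv_in 1 (u (steps n t))) (head 1%g t) l)) //.
by rewrite -prodM -(mvalM henv) (cochainV _ uU) (mval1 henv).
Qed.

Lemma msimplicial_transfers n (u : ('I_n -> G) -> multiplier B) y l m t :
    cochain u -> moves y l m -> size t = n.+1 ->
  transfers y (msimplicial u l t) (msimplicial u m (map ( *%g^~ y^-1%g) t)).
Proof.
move=> uU yE st; rewrite /msimplicial /simplicial steps_mulr //.
rewrite head_map_mulr ?st //.
have := @transfers_to_unit y l m _ (mval (inv_in 1 (u (steps n t))) (head 1%g t)) yE.
move=> /(_ (mval (u (steps n t)) (head 1%g t))).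
rewrite (mval_compat henv) prodM (moves_one yE) mul1r; apply.
by rewrite -prodM -(mvalM henv) (cochainV _ uU) (mval1 henv).
Qed.

(** Compatibility under y is checked at each block m: either 1_y vanishes there and both sides are
    0, or m is the image of a block l, where the hypothesis applies. *)
Lemma local_multiplier n (W : forall l, seq G -> units (A l)) :
    (forall y l m t, moves y l m -> size t = n.+1 ->
       transfers y (W l t) (W m (map ( *%g^~ y^-1%g) t))) ->
  exists f : ('I_n -> G) -> multiplier B,
    forall x g l, mval (f x) g l = uval (W l (vertices x g)).
Proof.
move=> WT; have /choice[f fE] (x : 'I_n -> G) : exists v, mval v =1
    (fun g => (fun l => uval (W l (vertices x g))) : product_ring A).
  apply: (mval_surj henv) => y g; apply: functional_extensionality_dep => m.
  rewrite prodM.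
  case: (idempotent_coord m (upa_idem alpha y)) => ym.
    by rewrite -(pshift_dom alpha) prodM ym !mul0r.
  have [l yE] := moves_exists ym.
  have [a [_ [al _ am _]]] := WT y l m _ yE (size_vertices x g).
  by rewrite ym mul1r vertices_mulr -am; apply: (moves_local yE).
by exists f => x g l; rewrite fE.
Qed.

Lemma cohomologous_of_local n (u1 u2 : ('I_n.+1 -> G) -> multiplier B)
    (V : forall l, seq G -> units (A l)) :
    cocycle (beta_star beta) u1 -> cocycle (beta_star beta) u2 ->
    (forall y l m t, moves y l m -> size t = n.+1 -> {in t, forall h, inside l h} ->
       transfers y (V l t) (V m (map ( *%g^~ y^-1%g) t))) ->
    (forall l t, size t = n.+2 -> {in t, forall h, inside l h} ->
       msimplicial u1 l t - msimplicial u2 l t = bd (V l) t) ->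
  cohomologous (beta_star beta) u1 u2.
Proof.
move=> [u1C u1Z] [u2C u2Z] VT VF.
pose F l t := msimplicial u1 l t - msimplicial u2 l t.
pose W l t := V l (map (retract l) t) - prism (retract l) (F l) t.
have insideE l t : {in map (retract l) t, forall h, inside l h}.
  by move=> _ /mapP[h _ ->]; exact: inside_retract.
(* Retracted simplices are inside l, so the first term has coboundary F o r; as F is a cocycle, the
   homotopy gives F o r - F for the second. *)
have bdW l t : size t = n.+2 -> bd (W l) t = F l t.
  move=> st; have FZ s : size s = n.+3 -> bd (F l) s = 0.
    move=> ss; rewrite /F bdB; apply/eqP; rewrite subr_eq0; apply/eqP/uval_inj.
    by rewrite !msimplicial_coboundary // u1Z u2Z.
  rewrite /W bdB (bd_map (retract l) (V l)) -VF ?size_map // -/(F l _).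
  have := prism_homotopy (retract l) (F l) t.
  rewrite (prism_eq0 _ FZ st) addr0 => ->.
  by rewrite opprB addrC subrK.
have WT y l m t : moves y l m -> size t = n.+1 ->
    transfers y (W l t) (W m (map ( *%g^~ y^-1%g) t)).
  move=> yE st; rewrite /W; apply: transfersB.
    have -> : map (retract m) (map ( *%g^~ y^-1%g) t) =
              map ( *%g^~ y^-1%g) (map (retract l) t).
      by rewrite -!map_comp; apply: eq_map => h; exact: retract_moves.
    by apply: VT; rewrite ?size_map //; exact: insideE.
  apply: (@prism_rel _ _ _ _ _ _ _ n.+1) => //; first exact: transfers0.
  - by move=> *; apply: transfersB.
  - by move=> h; exact: retract_moves.
  - by move=> s ss; apply: transfersB; apply: msimplicial_transfers.
have [f fE] := local_multiplier WT.
(* Gluing [- W] as well provides the inverse of [f]. *)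
have [k kE] : exists k : ('I_n -> G) -> multiplier B,
    forall x g l, mval (k x) g l = uval (- W l (vertices x g)).
  apply: (local_multiplier (W := fun l t => - W l t)) => y l m t yE st.
  rewrite -[- W l t]sub0r -[- W m _]sub0r.
  by apply: transfersB; [exact: transfers0|exact: WT].
have fC : cochain f.
  move=> x; exists (k x); split; [by exists (f x) => //; rewrite mul1r|
    by exists (k x) => //; rewrite mul1r| |];
  apply: (mval_inj henv) => g; apply: functional_extensionality_dep => l;
  by rewrite (mvalM henv) (mval1 henv) prodM fE kE uvalN ?[uinv _ * _]mulrC uvalV.
exists f => // x; apply: (mval_inj henv) => g; apply: functional_extensionality_dep => l.
rewrite (mvalM henv) prodM.
have := uval_msimplicial l (vertices x g) u1C.
have := uval_msimplicial l (vertices x g) u2C.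
have := @msimplicial_coboundary _ f l (vertices x g) fC (size_vertices x g).
rewrite !steps_vertices head_vertices => <- <- <-.
rewrite (@eq_bd _ _ n.+1 _ (W l)) ?size_vertices //; last first.
  move=> t st; apply: uval_inj; rewrite uval_msimplicial // fE.
  by rewrite vertices_steps.
by rewrite bdW ?size_vertices // -uvalD addrC subrK.
Qed.

(** * Comparison with the partial cocycles *)

Lemma inside_head l t : (0 < size t)%N -> {in t, forall h, inside l h} ->
  inside l (head 1%g t).
Proof. by case: t => // h t _; apply; exact: mem_head. Qed.

(** Shifting by h_0^-1 turns the factor 1_(h_0 h_i^-1) into 1_(h_0^-1) 1_(h_i^-1), and both
    idempotents are 1 at l. *)
Lemma pone_inside n l t : size t = n.+1 -> {in t, forall h, inside l h} ->
  pshift (head 1%g t)^-1%g (pone alpha (steps n t)) l = 1.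
Proof.
move=> st tl; have hl : inside l (head 1%g t) by apply: inside_head; rewrite ?st.
rewrite /pone.
have -> := big_morph (fun a => pshift (head 1%g t)^-1%g a l)
  (id1 := 1) (op1 := *%R) (id2 := 1) (op2 := *%R).
- rewrite big1 // => i _; rewrite partial_prod_steps // (pshift_upa_one henv).
  by rewrite mulKg prodM hl mul1r tl // mem_nth // st ltnS.
- by move=> a b; rewrite (pshiftM alpha).
- by rewrite (pshift_one alpha).
Qed.

(** The partial cocycle records the multiplier at base point 1, up to [pone]; the shift by h_0^-1
    moves the base point to h_0. *)
Lemma globalization_inside n (w : ('I_n -> G) -> product_ring A)
    (u : ('I_n -> G) -> multiplier B) l t :
    globalization alpha beta phi w u -> size t = n.+1 ->
    {in t, forall h, inside l h} ->
  uval (msimplicial u l t) = pshift (head 1%g t)^-1%g (w (steps n t)) l.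
Proof.
move=> [[uC _] wu] st tl; rewrite uval_msimplicial //.
have -> : w (steps n t) = pone alpha (steps n t) * mval (u (steps n t)) 1%g.
  apply: (env_inj henv); rewrite wu (env_M henv) (phi_mval henv) (rmult_phi henv) /=.
  by rewrite !invg1 !ga_act1.
rewrite (pshiftM alpha) prodM pone_inside // mul1r (mval_compat henv) prodM.
by rewrite invgK mul1g (inside_head _ tl) ?st // mul1r.
Qed.

Lemma pcochain_inside n (v : ('I_n -> G) -> product_ring A) l t :
    pcochain alpha v -> size t = n.+1 -> {in t, forall h, inside l h} ->
  pshift (head 1%g t)^-1%g (v (steps n t)) l *
  pshift (head 1%g t)^-1%g (inv_in (pone alpha (steps n t)) (v (steps n t))) l = 1.
Proof.
move=> vC st tl; have [_ _ vV _] := inv_inP (vC (steps n t)).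
by rewrite -prodM -(pshiftM alpha) vV pone_inside.
Qed.

Lemma globalization_unique n (w1 w2 : ('I_n.+1 -> G) -> product_ring A)
    (u1 u2 : ('I_n.+1 -> G) -> multiplier B) :
    globalization alpha beta phi w1 u1 -> globalization alpha beta phi w2 u2 ->
    pcohomologous alpha w1 w2 ->
  cohomologous (beta_star beta) u1 u2.
Proof.
move=> g1 g2 [v vC wv].
(* The homogeneous form of [v], meaningful only on simplices inside l. *)
pose V l := simplicial (fun h a => pshift h^-1%g a l) v.
apply: (cohomologous_of_local (V := V)) g1.1 g2.1 _ _ => [y l m t yE st tl|l t st tl].
  have := transfers_to_unit yE (pcochain_inside vC st tl).
  rewrite (pshift_comp henv) prodM (moves_one yE) mul1r /V /simplicial.
  by rewrite steps_mulr // head_map_mulr ?st // invgF.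
apply/eqP; rewrite subr_eq addrC; apply/eqP/uval_inj.
rewrite uvalD (globalization_inside g1) // (globalization_inside g2) // wv.
rewrite (pshiftM alpha) prodM; congr (_ * _).
rewrite (@simplicial_coboundary _ _ _ (fun g a => pa_act alpha g (one g^-1%g * a))
  _ (inside l) _ _ _ _ _ (fun x => inv_in (pone alpha x) (v x))) //.
- by move=> h a b _; rewrite (pshiftM alpha).
- by move=> h hl; rewrite (pshift_one alpha).
- move=> h x a hl; rewrite -[pa_act _ _ _]/(pshift x a) (pshift_comp henv) prodM hl.
  by rewrite mul1r invgM invgK.
- by move=> s ss sl; exact: pcochain_inside.
Qed.

(** On simplices inside a block [w] determines both globalizations, so the trivial cochain serves as
    V. *)
Lemma globalization_self n (w : ('I_n.+1 -> G) -> product_ring A)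
    (u u' : ('I_n.+1 -> G) -> multiplier B) :
    globalization alpha beta phi w u -> globalization alpha beta phi w u' ->
  cohomologous (beta_star beta) u u'.
Proof.
move=> g1 g2.
apply: (cohomologous_of_local (V := fun _ _ => 0)) g1.1 g2.1 _ _ => [*|l t st tl].
  exact: transfers0.
rewrite bd_sum big1 => [|i _]; last by rewrite oppr0 if_same.
apply/eqP; rewrite subr_eq0; apply/eqP/uval_inj.
by rewrite (globalization_inside g1) // (globalization_inside g2).
Qed.

End Product.

Theorem theorem5p3 (G : groupType) (L : Type) (A : L -> comPzRingType)
    (hA : forall l, indecomposable (A l))
    (alpha : unital_partial_action G (product_ring A))
    (B : rngType) (beta : global_action G B) (phi : product_ring A -> B)
    (henv : enveloping alpha beta phi) (n : nat) :
  (forall (w1 w2 : ('I_n.+1 -> G) -> product_ring A)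
      (u1 u2 : ('I_n.+1 -> G) -> multiplier B),
    pcocycle alpha w1 -> pcocycle alpha w2 ->
    globalization alpha beta phi w1 u1 -> globalization alpha beta phi w2 u2 ->
    pcohomologous alpha w1 w2 -> cohomologous (beta_star beta) u1 u2)
  /\
  (forall (w : ('I_n.+1 -> G) -> product_ring A)
      (u u' : ('I_n.+1 -> G) -> multiplier B),
    pcocycle alpha w ->
    globalization alpha beta phi w u -> globalization alpha beta phi w u' ->
    cohomologous (beta_star beta) u u').
Proof.
split=> [w1 w2 u1 u2 _ _|w u u' _]; first exact: globalization_unique.
exact: globalization_self.
Qed.
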